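(* The direct implicit difference scheme (DIDS) defined in the context is uniquely solvable and unconditionally stable in the sense that $$\|\boldsymbol u^k\|_\infty\le\|\boldsymbol u^0\|_\infty+\Gamma(1-\gamma)\max_{1\le s\le k}\frac{\|\boldsymbol f^s\|_\infty}{a^{(s,\gamma)}_1},\qquad k=1,2,\dots,M.$$
   Context: Let $0<\gamma<1$, $\alpha\in(0,2)$, $T>0$, $l>0$, and let $\kappa(x,t)>0$, $f(x,t)$, $\phi(x)$ be given functions for $x\in(-l,l)$, $t\in[0,T]$. Let $M,N,r$ be positive integers, $h=2l/N$, $x_i=-l+ih$ ($0\le i\le N$), $t_m=(m/M)^rT$ ($0\le m\le M$), $\tau_m=t_m-t_{m-1}$, $\kappa_i^m=\kappa(x_i,t_m)$, $f_i^m=f(x_i,t_m)$. Temporal coefficients: $a^{(m,\gamma)}_k=\frac1{\tau_k}\int_{t_{k-1}}^{t_k}\frac{ds}{(t_m-s)^\gamma}$ for $1\le k\le m\le M$. Spatial discretization. Let $\mu\in(\alpha,2]$, $\nu=\mu-\alpha$, $\kappa_\mu=1$ if $\mu\in(\alpha,2)$ and $\kappa_\mu=2$ if $\mu=2$, $c_{1,\alpha}=\frac{2^{\alpha-1}\alpha\Gamma(\frac{\alpha+1}{2})}{\sqrt\pi\,\Gamma(1-\alpha/2)}$, $C^h_{\alpha,\mu}=\frac{c_{1,\alpha}}{\nu h^\alpha}$. For a grid function $v$ with $v_0=v_N=0$ put $(-\Delta)^{\alpha/2}_{h,\mu}v_i=\sum_{j=1}^{N-1}a_{ij}v_j$ ($1\le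 i\le N-1$), where $$a_{ij}=C^h_{\alpha,\mu}\begin{cases}\sum\limits_{\ell=2}^{N-1}\frac{(\ell+1)^\nu-(\ell-1)^\nu}{\ell^\mu}+\frac{N^\nu-(N-1)^\nu}{N^\mu}+(2^\nu+\kappa_\mu-1)+\frac{2\nu}{\alpha N^\alpha},& j=i,\\[2mm] -\frac{2^\nu+\kappa_\mu-1}{2},& j=i\pm1,\\[1mm] -\frac{(|j-i|+1)^\nu-(|j-i|-1)^\nu}{2|j-i|^\mu},& j\neq i,\,i\pm1.\end{cases}$$ DIDS. The scheme determines $\{u_i^m\}$ by $$\frac1{\Gamma(1-\gamma)}\Big[a^{(m,\gamma)}_mu_i^m-\sum_{k=1}^{m-1}\big(a^{(m,\gamma)}_{k+1}-a^{(m,\gamma)}_k\big)u_i^k-a^{(m,\gamma)}_1u_i^0\Big]=-\kappa_i^m(-\Delta)^{\alpha/2}_{h,\mu}u_i^m+f_i^m$$ for $1\le i\le N-1$, $1\le m\le M$, with $u_0^m=u_N^m=0$ ($0\le m\le M$) and $u_i^0=\phi(x_i)$ ($1\le i\le N-1$). Write $\boldsymbol u^m=(u_1^m,\dots,u_{N-1}^m)^\top$, $\boldsymbol f^m=(f_1^m,\dots,f_{N-1}^m)^\top$, and $\|\boldsymbol v\|_\infty=\max_{1\le i\le N-1}|v_i|$. *)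

(* Defs.v *)
From HB Require Import structures.
From mathcomp Require Import all_boot all_order all_algebra.
From mathcomp Require Import all_classical all_reals all_analysis.

Set Implicit Arguments.
Unset Strict Implicit.
Unset Printing Implicit Defensive.

Import Order.TTheory GRing.Theory Num.Theory.
Import numFieldNormedType.Exports.

Local Open Scope classical_set_scope.
Local Open Scope ring_scope.

(* Euler's integral; it converges at every point where it is used below
   (1 - gamma, (alpha + 1) / 2 and 1 - alpha / 2 are all positive). *)
Definition Gamma (R : realType) (z : R) : R :=
  \int[lebesgue_measure]_(x in `]0, +oo[) (x `^ (z - 1) * expR (- x)).

Definition xgrid (R : realType) (l : R) (N i : nat) : R :=
  - l + i%:R * (2 * l / N%:R).

Definition tgrid (R : realType) (T : R) (M r m : nat) : R :=
  (m%:R / M%:R) ^+ r * T.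

Definition tstep (R : realType) (T : R) (M r k : nat) : R :=
  tgrid T M r k - tgrid T M r k.-1.

(* For k = m the integrand is singular at s = t_m, where [powR] and [^-1] give
   it the junk value 0; this is a null set and the integral is unaffected. *)
Definition acoef (R : realType) (gamma T : R) (M r m k : nat) : R :=
  (tstep T M r k)^-1 *
  \int[lebesgue_measure]_(s in `[tgrid T M r k.-1, tgrid T M r k])
    ((tgrid T M r m - s) `^ gamma)^-1.

Definition kappa_mu (R : realType) (mu : R) : R := if mu == 2 then 2 else 1.

Definition c1 (R : realType) (alpha : R) : R :=
  2 `^ (alpha - 1) * alpha * Gamma ((alpha + 1) / 2) /
  (Num.sqrt pi * Gamma (1 - alpha / 2)).

Definition Ch (R : realType) (alpha mu l : R) (N : nat) : R :=
  c1 alpha / ((mu - alpha) * (2 * l / N%:R) `^ alpha).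

Definition lapcoef (R : realType) (alpha mu l : R) (N i j : nat) : R :=
  let nu := mu - alpha in
  let d := `|i%:Z - j%:Z|%N in
  Ch alpha mu l N *
  (if d == 0%N then
     \sum_(2 <= p < N) ((p.+1%:R `^ nu - p.-1%:R `^ nu) / p%:R `^ mu)
     + (N%:R `^ nu - N.-1%:R `^ nu) / N%:R `^ mu
     + (2 `^ nu + kappa_mu mu - 1)
     + 2 * nu / (alpha * N%:R `^ alpha)
   else if d == 1%N then
     - ((2 `^ nu + kappa_mu mu - 1) / 2)
   else
     - ((d.+1%:R `^ nu - d.-1%:R `^ nu) / (2 * d%:R `^ mu))).

Definition fraclap (R : realType) (alpha mu l : R) (N : nat)
    (v : 'I_N.+1 -> R) (i : nat) : R :=
  \sum_(j < N.+1 | (0 < j < N)%N) lapcoef alpha mu l N i j * v j.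

(* The entry [u m i] is u_i^m, for 0 <= m <= M and 0 <= i <= N. *)
Definition DIDS (R : realType) (gamma alpha mu T l : R)
    (kappa f : R -> R -> R) (phi : R -> R) (M N r : nat)
    (u : 'M[R]_(M.+1, N.+1)) : Prop :=
  let a := acoef gamma T M r in
  let x := xgrid l N in
  let t := tgrid T M r in
  [/\ forall (m : 'I_M.+1) (i : 'I_N.+1), (0 < m)%N -> (0 < i < N)%N ->
        (Gamma (1 - gamma))^-1 *
          (a m m * u m i
           - \sum_(k < M.+1 | (0 < k < m)%N) (a m k.+1 - a m k) * u k i
           - a m 1%N * u ord0 i)
        = - kappa (x i) (t m) * fraclap alpha mu l (u m) i + f (x i) (t m),
      forall m : 'I_M.+1, u m ord0 = 0 /\ u m ord_max = 0
    & forall i : 'I_N.+1, (0 < i < N)%N -> u ord0 i = phi (x i)].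

(* Maximum over the interior nodes only; it is 0 when there are none (N = 1). *)
Definition infnorm (R : realType) (N : nat) (v : 'I_N.+1 -> R) : R :=
  \big[Num.max/0]_(i < N.+1 | (0 < i < N)%N) `|v i|.

(* Main.v *)
Require Import Defs.
From HB Require Import structures.
From mathcomp Require Import all_boot all_order all_algebra.
From mathcomp Require Import all_classical all_reals all_analysis.
From mathcomp Require Import measurable_realfun.
From mathcomp Require Import ring lra zify.
Set Implicit Arguments.
Unset Strict Implicit.
Unset Printing Implicit Defensive.
Import Order.TTheory GRing.Theory Num.Theory.
Import numFieldNormedType.Exports.
Local Open Scope ring_scope.

(** The scheme obeys a discrete maximum principle.  Write
    a_k for the temporal coefficient of index k at level m and
    G for Gamma (1 - gamma).  Two sign facts carry everything.

    In time, 0 < a_1 <= a_2 <= ... <= a_m: the coefficient a_k is the mean over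
    [t_{k-1}, t_k] of the increasing kernel s |-> (t_m - s)^(-gamma), so it lies
    between the values of the kernel at t_{k-1} and t_k ([acoef_ge],
    [acoef_le]).  For k = m the kernel blows up at the right end, and its
    integrability there has to be known for the mean to be finite; it follows
    from the bounded primitive - (t_m - s)^(1 - gamma) / (1 - gamma)
    ([integrable_bounded_primitive]).  The same criterion makes Euler's integral
    for G converge, so that G is a positive real ([Gamma_gt0]).

    In space, the matrix of the discrete fractional Laplacian has nonpositive
    off-diagonal entries and is diagonally dominant by rows, because the diagonal
    entry contains twice the full sum of the weights at distances 1 .. N-1
    ([lapcoef_dominant]).  Hence at a node i where |v| is maximal, the
    discrete Laplacian of v vanishes or has the sign of v_i ([fraclap_max]).

    Let now i be a node where |u^m| is maximal.  Multiplying the equation by G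
    and by the sign of u_i^m, the diffusion term only helps, which leaves
      a_m |u_i^m| <= sum_{0<k<m} (a_{k+1} - a_k) |u_i^k|
                     + a_1 (|u_i^0| + G |f_i^m| / a_1).
    If E bounds both the norms of u^k for 0 < k < m and the last parenthesis,
    the right-hand side is at most (a_m - a_1) E + a_1 E = a_m E, since the sum
    of the increments telescopes.  So E bounds u^m too ([DIDS_step]), and
    induction on the time level gives the stability estimate ([DIDS_stable]).

    Unique solvability comes from stability: all the equations of the scheme, at
    all levels together, form a square linear system [DIDS_op u = DIDS_rhs f phi].
    The estimate with f = 0 and phi = 0 shows that its kernel is trivial
    ([DIDS_op_ker]), and an injective endomorphism of a finite-dimensional space
    is surjective. *)

(** * Improper integrals of powers and Euler's Gamma function *)

Section integrals.
Local Open Scope classical_set_scope.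

(** On a compact subinterval the integral of f is a difference of two values of
    F, hence at most 2C; by monotone convergence along an exhaustion of the open
    interval the bound passes to the whole integral.  So f may blow up at the
    end points, as the singular kernels below do. *)
Lemma integrable_bounded_primitive (R : realType) (f F : R -> R) (a b C : R) :
  a < b ->
  (forall x, a < x < b -> 0 <= f x) ->
  (forall x, a < x < b -> {for x, continuous f}) ->
  (forall x, a < x < b -> is_derive x 1 F (f x)) ->
  (forall x, a < x < b -> `|F x| <= C) ->
  lebesgue_measure.-integrable `]a, b[ (EFin \o f).
Proof.
move=> ab f0 cf dF bF.
have mf : measurable_fun `]a, b[ f.
  apply: open_continuous_measurable_fun; first exact: interval_open.
  by move=> x; rewrite inE/= in_itv/= => /cf.
(* Dividing by n + 3 keeps the two end points of A n distinct and in order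
   for n = 0. *)
pose e n : R := (b - a) / n.+3%:R.
have e_gt0 n : 0 < e n by rewrite divr_gt0// subr_gt0.
have e_le n : 3 * e n <= b - a.
  by rewrite mulrCA ler_piMr ?subr_ge0 ?(ltW ab)// ler_pdivrMr// mul1r ler_nat.
have e_dec m n : (m <= n)%N -> e n <= e m.
  move=> mn; rewrite ler_wpM2l ?subr_ge0 ?(ltW ab)//.
  by rewrite lef_pV2 ?posrE// ler_nat.
pose A n : set R := `[a + e n, b - e n]%classic.
have AE n x : A n x -> a < x < b.
  rewrite /A/= in_itv/= => /andP[x1 x2].
  by rewrite (lt_le_trans _ x1) ?ltrDl// (le_lt_trans x2)// gtrBl.
have bigA : `]a, b[ = \bigcup_n A n.
  apply/seteqP; split=> x; last by case=> n _ /AE; rewrite /= in_itv.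
  rewrite /= in_itv/= => /andP[ax xb].
  pose d := Num.min (x - a) (b - x).
  have d0 : 0 < d by rewrite /d lt_min !subr_gt0 ax.
  have [n _ nP] : \forall n \near \oo, (b - a) / d <= n%:R.
    exact: nbhs_infty_ger.
  exists n => //; rewrite /A/= in_itv/=.
  have : e n <= d.
    rewrite /e ler_pdivrMr// mulrC -ler_pdivrMr//.
    by apply: le_trans (nP n _) _; rewrite //= ?ler_nat//; do 3 apply: leqW.
  by rewrite /d le_min => /andP[h1 h2]; apply/andP; split; lra.
have ndA : nondecreasing_seq A.
  move=> m n mn; apply/subsetPset => x; rewrite /A/= !in_itv/=.
  by have := e_dec _ _ mn => h /andP[h1 h2]; apply/andP; split; lra.
have intA n : (\int[lebesgue_measure]_(x in A n) (f x)%:E <= (2 * C)%:E)%E.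
  have [en en'] := (e_gt0 n, e_le n).
  have h1 : a < a + e n < b by apply/andP; split; lra.
  have h2 : a < b - e n < b by apply/andP; split; lra.
  rewrite (@continuous_FTC2 _ f F).
  - rewrite -EFinB lee_fin; have := bF _ h1; have := bF _ h2.
    by rewrite !ler_norml => /andP[? ?] /andP[? ?]; lra.
  - by have := e_le n; lra.
  - by apply: continuous_in_subspaceT => x; rewrite inE => /AE /cf.
  - split.
    + move=> x; rewrite in_itv/= => /andP[x1 x2].
      by apply: (@ex_derive _ _ _ _ _ _ _ (dF x _)); apply/andP; split; lra.
    + apply: cvg_at_right_filter.
      apply: differentiable_continuous; apply/derivable1_diffP.
      exact: (@ex_derive _ _ _ _ _ _ _ (dF _ h1)).
    + apply: cvg_at_left_filter.
      apply: differentiable_continuous; apply/derivable1_diffP.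
      exact: (@ex_derive _ _ _ _ _ _ _ (dF _ h2)).
  - move=> x; rewrite in_itv/= => /andP[x1 x2].
    rewrite derive1E; apply: (@derive_val _ _ _ _ _ _ _ (dF x _)).
    by apply/andP; split; lra.
apply/integrableP; split; first exact/measurable_EFinP.
under eq_integral => x.
  rewrite inE/= in_itv/= => /f0 fx; rewrite ger0_norm//.
  over.
rewrite bigA; apply: (@le_lt_trans _ _ (2 * C)%:E); last exact: ltry.
apply: (@cvge_to_le _ \oo _ R
    (fun n => \int[lebesgue_measure]_(x in A n) (f x)%:E)%E); last first.
  by apply: nearW => n; exact: intA.
apply: ge0_nondecreasing_set_cvg_integral => //.
- by move=> n; exact: measurable_itv.
- move=> n; apply/measurable_EFinP; apply: measurable_funS mf => //.
  by move=> x /AE; rewrite /= in_itv.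
- by move=> n x /AE /f0; rewrite lee_fin.
Qed.

Lemma integrable_powR_itv0 (R : realType) (g b : R) : g < 1 -> 0 < b ->
  lebesgue_measure.-integrable `]0, b[ (EFin \o (fun x : R => x `^ (- g))).
Proof.
move=> g1 b0; have g1' : 0 < 1 - g by rewrite subr_gt0.
apply: (@integrable_bounded_primitive _ _
  (fun x => (1 - g)^-1 * x `^ (1 - g)) _ _ ((1 - g)^-1 * b `^ (1 - g))) => //.
- by move=> x _; exact: powR_ge0.
- move=> x /andP[x0 _]; apply: differentiable_continuous.
  apply/derivable1_diffP; apply: derivable_powR.
  by rewrite in_itv/= x0.
- move=> x /andP[x0 _].
  have -> : x `^ (- g) = (1 - g)^-1 * ((1 - g) * x `^ (1 - g - 1)).
    by rewrite mulKf ?gt_eqF//; congr powR; ring.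
  exact: is_deriveZ (1 - g)^-1 _ _ _ (is_derive1_powR (1 - g) x0).
- move=> x /andP[x0 xb].
  rewrite ger0_norm ?mulr_ge0 ?powR_ge0 ?invr_ge0 ?(ltW g1')//.
  rewrite ler_pM2l ?invr_gt0// ge0_ler_powR ?nnegrE ?(ltW g1')//; exact: ltW.
Qed.

Lemma integrable_powR_sub (R : realType) (g a b c : R) : g < 1 ->
  a < b -> b <= c ->
  lebesgue_measure.-integrable `]a, b[
    (EFin \o (fun s : R => ((c - s) `^ g)^-1)).
Proof.
move=> g1 ab bc; have g1' : 0 < 1 - g by rewrite subr_gt0.
have c0 s : a < s < b -> 0 < c - s.
  by move=> /andP[_ sb]; rewrite subr_gt0 (lt_le_trans sb).
apply: (@integrable_bounded_primitive _ _
  (fun x => - (1 - g)^-1 * (c - x) `^ (1 - g)) _ _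
  ((1 - g)^-1 * (c - a) `^ (1 - g))) => //.
- by move=> x _; rewrite invr_ge0 powR_ge0.
- move=> x xab; apply: cvgV; first by rewrite gt_eqF// powR_gt0 ?c0.
  apply: (@continuous_comp _ _ _ (fun s => c - s) (@powR R ^~ g)).
    by apply: cvgB; [exact: cvg_cst|exact: cvg_id].
  apply: differentiable_continuous; apply/derivable1_diffP.
  by apply: derivable_powR; rewrite in_itv/= c0.
- move=> x xab; have x0 := c0 _ xab.
  have dc : is_derive x 1 (fun s => c - s) (- 1).
    rewrite -[- 1]add0r; apply: is_deriveB.
  have dp : is_derive (c - x) 1 (@powR R ^~ (1 - g)) ((1 - g) * (c - x) `^ (1 - g - 1)).
    exact: is_derive1_powR.
  have -> : ((c - x) `^ g)^-1 = - (1 - g)^-1 * ((1 - g) * (c - x) `^ (1 - g - 1) * - 1).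
    rewrite mulrN1 mulrNN mulKf ?gt_eqF// -powRN; congr powR; ring.
  have h := @is_derive1_comp R (@powR R ^~ (1 - g)) (fun s => c - s) _ _ _ dp dc.
  exact: (@is_deriveZ _ _ _ _ (- (1 - g)^-1) _ _ _ h).
- move=> x xab; have x0 := c0 _ xab; case/andP: xab => ax xb.
  rewrite mulNr normrN.
  rewrite ger0_norm ?mulr_ge0 ?powR_ge0 ?invr_ge0 ?(ltW g1')//.
  rewrite ler_pM2l ?invr_gt0// ge0_ler_powR ?nnegrE ?(ltW g1')//; lra.
Qed.

Lemma Rintegral_cc_oo (R : realType) (f : R -> R) (a b : R) :
  lebesgue_measure.-integrable `]a, b[ (EFin \o f) ->
  \int[lebesgue_measure]_(x in `[a, b]) f x =
  \int[lebesgue_measure]_(x in `]a, b[) f x.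
Proof.
by move=> fi; rewrite /Rintegral integral_itv_bndoo//; exact: measurable_int fi.
Qed.

Lemma Rintegral_cst_oo (R : realType) (a b C : R) : a < b ->
  \int[lebesgue_measure]_(x in `]a, b[) C = C * (b - a).
Proof.
move=> ab; rewrite Rintegral_cst//= lebesgue_measure_itv/= lte_fin ab.
by rewrite -EFinB.
Qed.

Lemma integrable_cst_oo (R : realType) (a b C : R) :
  lebesgue_measure.-integrable `]a, b[ (EFin \o (fun=> C : R)).
Proof.
apply/integrableP; split; first exact/measurable_EFinP.
rewrite integral_cst//= lebesgue_measure_itv/=; case: ifP => _.
  by rewrite -EFinB -EFinM ltry.
by rewrite mule0 ltry.
Qed.

(** The integrand x^(-g) e^(-x) is dominated by x^(-g) on ]0, 1[ and by e^(-x)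
    on [1, +oo[, so the integral is finite, and it is at least e^(-1) because the
    integrand is at least e^(-1) on ]0, 1[.  Finiteness matters: a divergent
    integral would be given the real value 0. *)
Lemma Gamma_gt0 (R : realType) (g : R) : 0 < g -> g < 1 -> 0 < Gamma (1 - g).
Proof.
move=> g0 g1; rewrite /Gamma.
have -> : 1 - g - 1 = - g by ring.
set f := fun x : R => x `^ (- g) * expR (- x).
have mf : measurable_fun [set: R] f.
  by apply: measurable_funM => //;
    apply: measurableT_comp => //; exact: measurableT_comp.
have f_ge0 x : 0 <= f x by rewrite mulr_ge0 ?powR_ge0 ?expR_ge0.
have mE (D : set R) : measurable D -> measurable_fun D (EFin \o f).
  by move=> mD; apply/measurable_EFinP; apply: measurable_funTS.
have i0 : lebesgue_measure.-integrable `]0, 1[ (EFin \o f).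
  apply: le_integrable (integrable_powR_itv0 g1 ltr01) => //=; first exact: mE.
  move=> x; rewrite /= in_itv/= => /andP[x0 x1].
  rewrite lee_fin !ger0_norm ?powR_ge0// ler_piMr ?powR_ge0//.
  by rewrite -expR0 ler_expR; lra.
have i1 : lebesgue_measure.-integrable `[1, +oo[ (EFin \o f).
  have ie : lebesgue_measure.-integrable `[1, +oo[ (EFin \o exponential_pdf (1 : R)).
    by apply: integrableS (integrable_exponential_pdf ltr01).
  apply: le_integrable ie => //=; first exact: mE.
  move=> x; rewrite /= in_itv/= andbT => x1.
  rewrite lee_fin !ger0_norm ?exponential_pdf_ge0//.
  rewrite exponential_pdfE ?mul1r ?mulN1r; last lra.
  rewrite ler_piMl ?expR_ge0// -(powRr0 x) ler_powR// oppr_le0; exact: ltW.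
have i01 : lebesgue_measure.-integrable `]0, +oo[ (EFin \o f).
  have -> : `]0, +oo[%classic = `]0, 1[%classic `|` `[1, +oo[%classic :> set R.
    by rewrite -itv_bndbnd_setU// bnd_simp.
  apply/integrableP; split; first by apply: mE; exact: measurableU.
  rewrite ge0_integral_setU//=.
  - case/integrableP: i0 => _ h0; case/integrableP: i1 => _ h1.
    exact: lte_add_pinfty.
  - by apply/measurable_EFinP; apply: measurable_funTS; exact: measurableT_comp.
  - apply/disj_setPS => x [] /=; rewrite !in_itv/= andbT => /andP[_ x1].
    by rewrite leNgt x1.
apply: (@lt_le_trans _ _ (expR (- 1))); first exact: expR_gt0.
have -> : expR (-1) = \int[lebesgue_measure]_(x in `]0, 1[) expR (- 1) :> R.
  by rewrite Rintegral_cst_oo// subr0 mulr1.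
apply: (@le_trans _ _ (\int[lebesgue_measure]_(x in `]0, 1[) f x)).
  apply: le_Rintegral => //; first exact: integrable_cst_oo.
  move=> x; rewrite /= in_itv/= => /andP[x0 x1].
  rewrite -[leLHS]mul1r ler_pM ?expR_ge0//; last by rewrite ler_expR; lra.
  rewrite -(powRr0 x) ger_powR ?x0 ?ltW//; lra.
rewrite fine_le ?integrable_fin_num//.
apply: ge0_subset_integral => //=; first exact: mE.
  by move=> x _; rewrite lee_fin.
by move=> x; rewrite /= !in_itv/= => /andP[->].
Qed.

End integrals.

(** * Monotonicity of the temporal coefficients *)

Section temporal_coefficients.
Context {R : realType} (gamma T : R) (M r : nat).
Hypotheses (gamma_gt0 : 0 < gamma) (gamma_lt1 : gamma < 1) (T_gt0 : 0 < T).
Hypotheses (M_gt0 : (0 < M)%N) (r_gt0 : (0 < r)%N).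

Lemma tgrid_lt m n : (m < n)%N -> tgrid T M r m < tgrid T M r n.
Proof.
move=> mn; rewrite /tgrid ltr_pM2r// ltrXn2r -?lt0n ?divr_ge0//.
by rewrite ltr_pM2r ?invr_gt0 ?ltr0n// ltr_nat.
Qed.

Lemma tgrid_le m n : (m <= n)%N -> tgrid T M r m <= tgrid T M r n.
Proof. by rewrite leq_eqVlt => /predU1P[->//|/tgrid_lt/ltW]. Qed.

Lemma acoef_ge m k : (0 < k)%N -> (k <= m)%N ->
  ((tgrid T M r m - tgrid T M r k.-1) `^ gamma)^-1 <= acoef gamma T M r m k.
Proof.
move=> k0 km; have km1 : (k.-1 < m)%N by rewrite prednK.
have kk1 : tgrid T M r k.-1 < tgrid T M r k by apply: tgrid_lt; rewrite prednK.
have kM := tgrid_le km; have k1M := tgrid_lt km1.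
have i := integrable_powR_sub gamma_lt1 kk1 kM.
rewrite /acoef Rintegral_cc_oo// /tstep ler_pdivlMl ?subr_gt0// mulrC.
rewrite -(Rintegral_cst_oo _ kk1); apply: le_Rintegral => //.
  exact: integrable_cst_oo.
move=> s; rewrite /= in_itv/= => /andP[s1 s2].
rewrite lef_pV2 ?posrE ?powR_gt0 ?subr_gt0 ?(lt_le_trans s2)//.
rewrite ge0_ler_powR ?(ltW gamma_gt0)// ?nnegrE; lra.
Qed.

Lemma acoef_le m k : (0 < k)%N -> (k < m)%N ->
  acoef gamma T M r m k <= ((tgrid T M r m - tgrid T M r k) `^ gamma)^-1.
Proof.
move=> k0 km.
have kk1 : tgrid T M r k.-1 < tgrid T M r k by apply: tgrid_lt; rewrite prednK.
have kM := tgrid_lt km.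
have i := integrable_powR_sub gamma_lt1 kk1 (ltW kM).
rewrite /acoef Rintegral_cc_oo// /tstep ler_pdivrMl ?subr_gt0// mulrC.
rewrite -(Rintegral_cst_oo _ kk1); apply: le_Rintegral => //.
  exact: integrable_cst_oo.
move=> s; rewrite /= in_itv/= => /andP[s1 s2].
rewrite lef_pV2 ?posrE ?powR_gt0 ?subr_gt0 ?(lt_trans s2)//.
rewrite ge0_ler_powR ?(ltW gamma_gt0)// ?nnegrE; lra.
Qed.

Lemma acoef_gt0 m k : (0 < k)%N -> (k <= m)%N -> 0 < acoef gamma T M r m k.
Proof.
move=> k0 km; apply: lt_le_trans (acoef_ge k0 km).
by rewrite invr_gt0 powR_gt0// subr_gt0 tgrid_lt// prednK.
Qed.

(** The value of the kernel at t_k separates the means over the two adjacent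
    intervals. *)
Lemma acoef_mono m k : (0 < k)%N -> (k < m)%N ->
  acoef gamma T M r m k <= acoef gamma T M r m k.+1.
Proof. by move=> k0 km; apply: le_trans (acoef_le k0 km) (@acoef_ge m k.+1 isT km). Qed.

End temporal_coefficients.

(** * Diagonal dominance of the discrete fractional Laplacian *)

Lemma sum_ord_itv (V : nmodType) (n a b : nat) (F : nat -> V) : (b <= n)%N ->
  \sum_(j < n | (a <= j < b)%N) F j = \sum_(a <= j < b) F j.
Proof.
move=> bn; rewrite [RHS](big_nat_widenl _ 0)//= (big_nat_widen _ _ _ _ _ bn) big_mkord.
by apply: eq_bigl => j /=.
Qed.

Lemma Gamma_ge0 (R : realType) (z : R) : 0 <= Gamma z.
Proof. by apply: Rintegral_ge0 => x _; rewrite mulr_ge0 ?powR_ge0 ?expR_ge0. Qed.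

Section spatial_coefficients.
Context {R : realType} (alpha mu l : R) (N : nat).
Hypothesis alpha_gt0 : 0 < alpha.
Hypotheses (mu_gt : alpha < mu) (l_gt0 : 0 < l).

(** Normalized modulus of the matrix entries at distance d > 0 from the
    diagonal; with it the sum of a row becomes a sum over distances. *)
Definition lapweight (d : nat) : R :=
  if d == 1%N then (2 `^ (mu - alpha) + kappa_mu mu - 1) / 2
  else (d.+1%:R `^ (mu - alpha) - d.-1%:R `^ (mu - alpha)) / (2 * d%:R `^ mu).

(** Only the sign of the constant matters for the maximum principle, and it
    follows from Gamma being the integral of a nonnegative function. *)
Lemma Ch_ge0 : 0 <= Ch alpha mu l N.
Proof.
rewrite /Ch /c1 !(divr_ge0, mulr_ge0, powR_ge0, Gamma_ge0, sqrtr_ge0)//.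
- exact: ltW.
- by rewrite subr_ge0 ltW.
Qed.

Lemma powR_nat_le (m n : nat) : (m <= n)%N ->
  m%:R `^ (mu - alpha) <= n%:R `^ (mu - alpha) :> R.
Proof.
by move=> mn; rewrite ge0_ler_powR ?nnegrE ?ler_nat// subr_ge0 ltW.
Qed.

Lemma kappa_mu_ge1 : 1 <= kappa_mu mu.
Proof. by rewrite /kappa_mu; case: ifP => // _; rewrite ler1n. Qed.

Lemma lapweight_ge0 d : 0 <= lapweight d.
Proof.
rewrite /lapweight; case: ifP => _.
  by rewrite divr_ge0// -addrA addr_ge0 ?powR_ge0// subr_ge0 kappa_mu_ge1.
rewrite divr_ge0 ?mulr_ge0 ?powR_ge0// subr_ge0.
by apply: powR_nat_le; lia.
Qed.

Lemma lapcoef_off i j : i != j ->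
  lapcoef alpha mu l N i j = - (Ch alpha mu l N * lapweight `|i%:Z - j%:Z|%N).
Proof.
move=> ij; rewrite /lapcoef /lapweight ifF; last by lia.
by rewrite -[RHS]mulrN; congr (_ * _); case: ifP.
Qed.

Lemma lapcoef_diag i : (1 < N)%N ->
  Ch alpha mu l N * (2 * \sum_(1 <= p < N) lapweight p) <= lapcoef alpha mu l N i i.
Proof.
move=> N1; rewrite /lapcoef subrr absz0 eqxx ler_wpM2l ?Ch_ge0//.
rewrite big_ltn// mulrDr mulr_sumr.
have -> : \sum_(2 <= p < N) 2 * lapweight p =
    \sum_(2 <= p < N) ((p.+1%:R `^ (mu - alpha) - p.-1%:R `^ (mu - alpha))
                       / p%:R `^ mu).
  apply: eq_big_nat => p /andP[p2 _]; rewrite /lapweight ifF; last by lia.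
  by rewrite mulrCA invfM mulVKf// pnatr_eq0.
rewrite /lapweight eqxx mulrCA mulfV ?mulr1 ?pnatr_eq0//.
set A := \sum_(_ <= _ < _) _; set B := 2 `^ _ + _ - 1.
set X := _ / N%:R `^ mu; set Y := _ / (alpha * _).
have X0 : 0 <= X.
  by rewrite divr_ge0 ?powR_ge0// subr_ge0 powR_nat_le// leq_pred.
have Y0 : 0 <= Y.
  by rewrite divr_ge0 ?mulr_ge0 ?powR_ge0 ?subr_ge0// ltW.
lra.
Qed.

Lemma sum_lapweight_le n : (n <= N)%N ->
  \sum_(1 <= p < n) lapweight p <= \sum_(1 <= p < N) lapweight p.
Proof.
move=> nN; have [n0|n0] := leqP n 0.
  by rewrite big_geq ?sumr_ge0 ?(leq_trans n0)// => p _; exact: lapweight_ge0.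
rewrite [leRHS](big_cat_nat _ nN)//= lerDl sumr_ge0// => p _.
exact: lapweight_ge0.
Qed.

(** Seen from row i the distances to the left run over 1 .. i-1 and those to
    the right over 1 .. N-1-i; each of these two sums of weights is at most the
    full sum over 1 .. N-1, which the diagonal entry contains twice. *)
Lemma lapcoef_dominant i : (0 < i < N)%N ->
  \sum_(j < N.+1 | (0 < j < N)%N && (j != i :> nat)) - lapcoef alpha mu l N i j
  <= lapcoef alpha mu l N i i.
Proof.
move=> /andP[i0 iN]; apply: le_trans (lapcoef_diag i _); last exact: leq_ltn_trans iN.
rewrite (eq_bigr (fun j : 'I_N.+1 =>
    Ch alpha mu l N * lapweight `|i%:Z - j%:Z|%N)); last first.
  by move=> j /andP[_ ji]; rewrite lapcoef_off 1?eq_sym// opprK.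
rewrite -mulr_sumr ler_wpM2l ?Ch_ge0// big_mkcondr/=.
rewrite (@sum_ord_itv _ _ 1 N (fun j =>
    if j != i then lapweight `|i%:Z - j%:Z|%N else 0))//.
rewrite (big_cat_nat i0 (ltnW iN))/= [X in _ + X <= _]big_ltn// eqxx/= add0r.
rewrite mulr_natl mulr2n.
apply: lerD.
  rewrite (eq_big_nat _ _ (F2 := fun j => lapweight (i - j)%N)); last first.
    by move=> j /andP[j0 ji]; rewrite ifT; [congr lapweight|]; lia.
  rewrite big_nat_rev/= (eq_big_nat _ _ (F2 := lapweight)); last first.
    by move=> j /andP[j0 ji]; congr lapweight; lia.
  exact/sum_lapweight_le/ltnW.
rewrite -(add1n i) big_addn.
rewrite (eq_big_nat _ _ (F2 := lapweight)); last first.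
  by move=> j /andP[j0 ji]; rewrite ifT; [congr lapweight|]; lia.
exact/sum_lapweight_le/leq_subr.
Qed.

(** Discrete maximum principle: at a node where |v| is maximal, the diagonal
    term has the sign of v_i and outweighs all the others together. *)
Lemma fraclap_max (v : 'I_N.+1 -> R) (i : 'I_N.+1) : (0 < i < N)%N ->
  (forall j : 'I_N.+1, (0 < j < N)%N -> `|v j| <= `|v i|) ->
  0 <= Num.sg (v i) * fraclap alpha mu l v i.
Proof.
move=> iN vmax; rewrite /fraclap (bigD1 i)//= mulrDr mulrCA -normrEsg.
have dom := ler_wpM2r (normr_ge0 (v i)) (lapcoef_dominant iN).
rewrite -lerBlDr sub0r; apply: le_trans dom.
rewrite -mulrN -sumrN mulr_sumr mulr_suml; apply: ler_sum => j /andP[jN ji].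
have a0 : 0 <= - lapcoef alpha mu l N i j.
  by rewrite lapcoef_off 1?eq_sym// opprK mulr_ge0 ?Ch_ge0 ?lapweight_ge0.
rewrite -mulNr mulrCA ler_wpM2l//.
apply: le_trans (vmax _ jN); apply: le_trans (ler_norm _) _.
rewrite normrM ler_piMl//.
by rewrite normr_sg; case: (v i != 0).
Qed.

End spatial_coefficients.

(** * Stability of the scheme *)

Lemma infnorm_ge0 (R : realType) (N : nat) (v : 'I_N.+1 -> R) : 0 <= infnorm v.
Proof. exact: bigmax_ge_id. Qed.

Lemma le_infnorm (R : realType) (N : nat) (v : 'I_N.+1 -> R) (i : 'I_N.+1) :
  (0 < i < N)%N -> `|v i| <= infnorm v.
Proof. by move=> iN; exact: le_bigmax_cond. Qed.

(** To bound the norm it suffices to look at nodes where |v| is maximal; the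
    bound is required to be nonnegative for the case without interior node. *)
Lemma infnorm_le_max (R : realType) (N : nat) (v : 'I_N.+1 -> R) (E : R) :
  0 <= E ->
  (forall i : 'I_N.+1, (0 < i < N)%N ->
     (forall j : 'I_N.+1, (0 < j < N)%N -> `|v j| <= `|v i|) -> `|v i| <= E) ->
  infnorm v <= E.
Proof.
move=> E0 vE; apply: bigmax_le => // j jN.
pose P (k : 'I_N.+1) := (0 < k < N)%N.
case: (@Order.TotalTheory.arg_maxP _ _ _ j P (fun k => `|v k|) jN) => i iN imax.
by apply: le_trans (imax _ jN) (vE _ iN imax).
Qed.

Section scheme.
Context {R : realType} (gamma alpha mu T l : R) (kappa : R -> R -> R).
Context (M N r : nat).
Hypotheses (gamma_gt0 : 0 < gamma) (gamma_lt1 : gamma < 1).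
Hypotheses (alpha_gt0 : 0 < alpha) (mu_gt : alpha < mu).
Hypotheses (T_gt0 : 0 < T) (l_gt0 : 0 < l).
Hypothesis kappa_gt0 :
  forall x t : R, - l < x < l -> 0 <= t <= T -> 0 < kappa x t.
Hypotheses (M_gt0 : (0 < M)%N) (N_gt0 : (0 < N)%N) (r_gt0 : (0 < r)%N).

Local Notation G := (Gamma (1 - gamma)).
Local Notation a := (acoef gamma T M r).

Lemma xgrid_itv i : (0 < i < N)%N -> - l < xgrid l N i < l.
Proof.
move=> /andP[i0 iN]; have N0 : (0 : R) < N%:R by rewrite ltr0n.
rewrite /xgrid ltrDl mulr_gt0 ?ltr0n// ?divr_gt0 ?mulr_gt0//=.
have : i%:R * (2 * l / N%:R) < 2 * l.
  by rewrite mulrCA gtr_pMr ?mulr_gt0// ltr_pdivrMr// mul1r ltr_nat.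
lra.
Qed.

Lemma tgrid_itv m : (m <= M)%N -> 0 <= tgrid T M r m <= T.
Proof.
move=> mM; have M0 : (0 : R) < M%:R by rewrite ltr0n.
rewrite /tgrid mulr_ge0 ?exprn_ge0 ?divr_ge0 ?(ltW T_gt0)//=.
by rewrite ler_piMl ?(ltW T_gt0)// exprn_ile1 ?divr_ge0// ler_pdivrMr// mul1r ler_nat.
Qed.

Lemma sum_acoef_increments (m : nat) : (0 < m)%N -> (m <= M.+1)%N ->
  \sum_(k < M.+1 | (0 < k < m)%N) (a m k.+1 - a m k) = a m m - a m 1%N.
Proof.
move=> m0 mM; rewrite (sum_ord_itv 1 (fun k => a m k.+1 - a m k) mM).
exact: telescope_sumr.
Qed.

(** One time level: the bound E is reproduced because the coefficients of the
    history are nonnegative and add up to a_m, as a_1 + (a_m - a_1). *)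
Lemma DIDS_step (f : R -> R -> R) (phi : R -> R) (u : 'M[R]_(M.+1, N.+1))
    (m : 'I_M.+1) (E : R) :
  DIDS gamma alpha mu T l kappa f phi r u -> (0 < m)%N ->
  (forall k : 'I_M.+1, (0 < k < m)%N -> infnorm (u k) <= E) ->
  infnorm (u ord0) + G * (infnorm (fun i : 'I_N.+1 =>
    f (xgrid l N i) (tgrid T M r m)) / a m 1%N) <= E ->
  infnorm (u m) <= E.
Proof.
move=> [eqn _ _] m0 uE fE; have G0 : 0 < G by exact: Gamma_gt0.
have a1 : 0 < a m 1%N by exact: acoef_gt0.
have am : 0 < a m m by exact: acoef_gt0.
set F := infnorm (fun i : 'I_N.+1 => f (xgrid l N i) (tgrid T M r m)) in fE.
have E0 : 0 <= E.
  apply: le_trans fE; rewrite addr_ge0 ?infnorm_ge0// mulr_ge0 ?(ltW G0)//.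
  by rewrite divr_ge0 ?infnorm_ge0// ltW.
apply: infnorm_le_max => // i iN imax.
have /= L0 := fraclap_max alpha_gt0 mu_gt l_gt0 iN imax.
have K0 := kappa_gt0 (xgrid_itv iN) (tgrid_itv (ltn_ord m)).
move: (eqn m i m0 iN).
set L := fraclap _ _ _ _ _ in L0 *; set S := \sum_(_ < _ | _) _.
set K := kappa _ _ in K0 *; set fi := f _ _.
have fiF : `|fi| <= F.
  exact: (@le_infnorm _ _ (fun i : 'I_N.+1 => f (xgrid l N i) (tgrid T M r m)) i).
have SE : `|S| <= (a m m - a m 1%N) * E.
  rewrite -sum_acoef_increments// 1?ltnW// mulr_suml.
  apply: le_trans (ler_norm_sum _ _ _) _; apply: ler_sum => k /andP[k0 km].
  have da : 0 <= a m k.+1 - a m k by rewrite subr_ge0 acoef_mono.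
  rewrite normrM ger0_norm// ler_wpM2l//.
  by apply: le_trans (le_infnorm _ iN) (uE k _); rewrite k0.
have u0 := @le_infnorm _ _ (u ord0) i iN.
(* Clear the factor G^-1 and isolate the terms at node i and level m. *)
move=> /(congr1 (fun z => G * z)); rewrite mulVKf ?gt_eqF// => eqi.
have {}eqi : a m m * u m i + G * K * L = S + a m 1%N * u ord0 i + G * fi.
  by rewrite mulrDr mulNr in eqi; lra.
rewrite -(ler_pM2l am).
(* The diffusion term may be added since its product with the sign of u_i^m is
   nonnegative. *)
have h1 : a m m * `|u m i| <= Num.sg (u m i) * (a m m * u m i + G * K * L).
  rewrite mulrDr mulrCA -normrEsg lerDl mulrCA mulr_ge0// mulr_ge0// ltW//.
apply: le_trans h1 _; rewrite eqi.
apply: (@le_trans _ _ `|S + a m 1%N * u ord0 i + G * fi|).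
  apply: le_trans (ler_norm _) _; rewrite normrM ler_piMl//.
  by rewrite normr_sg; case: (u m i != 0).
apply: le_trans (ler_normD _ _) _; apply: le_trans (lerD (ler_normD _ _) (lexx _)) _.
rewrite [`|a m 1%N * _|]normrM [`|G * _|]normrM (gtr0_norm a1) (gtr0_norm G0).
have h2 : a m 1%N * `|u ord0 i| + G * `|fi| <= a m 1%N * E.
  apply: le_trans (ler_wpM2l (ltW a1) fE); rewrite mulrDr lerD ?ler_pM2l//.
  by rewrite mulrCA [a m 1%N * _]mulrC divfK ?gt_eqF// ler_pM2l.
by rewrite -addrA; apply: le_trans (lerD SE h2) _; lra.
Qed.

Lemma DIDS_stable (f : R -> R -> R) (phi : R -> R) (u : 'M[R]_(M.+1, N.+1)) :
  DIDS gamma alpha mu T l kappa f phi r u ->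
  forall k : 'I_M.+1, (0 < k)%N ->
    infnorm (u k) <=
      infnorm (u ord0) +
      G *
        \big[Num.max/0]_(1 <= s < k.+1)
          (infnorm (fun i : 'I_N.+1 => f (xgrid l N i) (tgrid T M r s)) / a s 1%N).
Proof.
move=> uP k; have G0 : 0 < G by exact: Gamma_gt0.
pose H s := infnorm (fun i : 'I_N.+1 => f (xgrid l N i) (tgrid T M r s)) / a s 1%N.
rewrite -/(H _); set E := leRHS => k0.
(* Strong induction on the level, with a bound fixed at the final level k. *)
suff uE n (m : 'I_M.+1) : (m <= n)%N -> (0 < m <= k)%N -> infnorm (u m) <= E.
  by apply: (uE k) => //; rewrite k0 leqnn.
elim: n m => [m|n IHn m mn /andP[m0 mk]]; first by lia.
apply: (DIDS_step uP m0) => [j /andP[j0 jm]|].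
  by apply: IHn; lia.
rewrite lerD2l ler_pM2l//.
by apply: (@le_bigmax_seq _ _ _ _ _ _ _ H) => //; rewrite mem_index_iota m0.
Qed.

(** * Unique solvability *)

Lemma boundary_node (i : 'I_N.+1) :
  ~~ (0 < i < N)%N -> i = ord0 \/ i = ord_max.
Proof.
move=> iN; have : (i = 0 :> nat \/ i = N :> nat)%N by have := ltn_ord i; lia.
by case=> iE; [left|right]; apply: val_inj.
Qed.

Lemma injective_endo_surj (F : fieldType) (V : vectType F) (h : {linear V -> V}) :
  (forall v, h v = 0 -> v = 0) -> forall w, exists v, h v = w.
Proof.
move=> ker0 w; have k0 : lker (linfun h) == 0%VS.
  by apply/lker0P => x y; rewrite !lfunE => /= hxy; apply/eqP; rewrite -subr_eq0;
    apply/eqP/ker0; rewrite linearB hxy subrr.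
by exists ((linfun h)^-1%VF w); rewrite -[LHS](lfunE h) lker0_lfunVK.
Qed.

(** The left-hand sides of the scheme, the diffusion term being moved to the
    left.  At the initial level and at the boundary nodes the equation only
    prescribes the value, so the operator is the identity there; this makes the
    system square. *)
Definition DIDS_op (u : 'M[R]_(M.+1, N.+1)) : 'M[R]_(M.+1, N.+1) :=
  \matrix_(m, i)
    if (0 < i < N)%N && (0 < m)%N then
      G^-1 * (a m m * u m i
              - \sum_(k < M.+1 | (0 < k < m)%N) (a m k.+1 - a m k) * u k i
              - a m 1%N * u ord0 i)
      + kappa (xgrid l N i) (tgrid T M r m) * fraclap alpha mu l (u m) i
    else u m i.

Definition DIDS_rhs (f : R -> R -> R) (phi : R -> R) : 'M[R]_(M.+1, N.+1) :=
  \matrix_(m, i)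
    if (0 < i < N)%N then
      if (0 < m)%N then f (xgrid l N i) (tgrid T M r m) else phi (xgrid l N i)
    else 0.

Lemma DIDS_opP (f : R -> R -> R) (phi : R -> R) (u : 'M[R]_(M.+1, N.+1)) :
  DIDS gamma alpha mu T l kappa f phi r u <-> DIDS_op u = DIDS_rhs f phi.
Proof.
split=> [[eqn bnd init]|/matrixP uP].
  apply/matrixP => m i; rewrite !mxE.
  have [iN|iN] /= := boolP (0 < i < N)%N; last first.
    case: (boundary_node iN) => ->.
    - by case: (bnd m).
    - by case: (bnd m).
  have [m0|] := ltnP 0 m; first by rewrite eqn// mulNr addrC addrA subrr add0r.
  by rewrite leqn0 => /eqP m0; rewrite -init//; congr (u _ _); exact: val_inj.
split=> [m i m0 iN|m|i iN].
- by have := uP m i; rewrite !mxE iN m0 /= => <-; rewrite mulNr [RHS]addrC addrK.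
- have := uP m ord0; have := uP m ord_max; rewrite !mxE /= ltnn andbF/=.
  by move=> -> ->.
- by have := uP ord0 i; rewrite !mxE /= iN.
Qed.

Lemma fraclap_linear (c : R) (v w : 'I_N.+1 -> R) i :
  fraclap alpha mu l (fun j => c * v j + w j) i =
  c * fraclap alpha mu l v i + fraclap alpha mu l w i.
Proof.
rewrite /fraclap mulr_sumr -big_split/=; apply: eq_bigr => j _; ring.
Qed.

Lemma DIDS_op_linear : linear DIDS_op.
Proof.
move=> c u v; apply/matrixP => m i; rewrite !mxE; case: ifP => // _.
have -> : (c *: u + v) m = (fun j => c * u m j + v m j).
  by apply/funext => j; rewrite !mxE.
rewrite fraclap_linear.
have -> : \sum_(k < M.+1 | (0 < k < m)%N) (a m k.+1 - a m k) * (c *: u + v) k i =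
    c * \sum_(k < M.+1 | (0 < k < m)%N) (a m k.+1 - a m k) * u k i
    + \sum_(k < M.+1 | (0 < k < m)%N) (a m k.+1 - a m k) * v k i.
  by rewrite mulr_sumr -big_split/=; apply: eq_bigr => k _; rewrite !mxE; ring.
ring.
Qed.

HB.instance Definition _ := GRing.isLinear.Build R
  'M[R]_(M.+1, N.+1) 'M[R]_(M.+1, N.+1) *:%R DIDS_op DIDS_op_linear.

(** An element of the kernel solves the scheme with zero data, hence vanishes by
    stability. *)
Lemma DIDS_op_ker (u : 'M[R]_(M.+1, N.+1)) : DIDS_op u = 0 -> u = 0.
Proof.
move=> u0; have uP : DIDS gamma alpha mu T l kappa (fun _ _ => 0) (fun=> 0) r u.
  by apply/DIDS_opP; rewrite u0; apply/matrixP => m i; rewrite !mxE !if_same.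
have norm0 : infnorm (fun _ : 'I_N.+1 => 0 : R) = 0.
  apply: big1_idem => [|i _]; first exact: maxxx.
  by rewrite normr0.
have [_ bnd init] := uP.
have u00 : infnorm (u ord0) = 0.
  apply: big1_idem => [|i iN]; first exact: maxxx.
  by rewrite init// normr0.
apply/matrixP => m i; rewrite mxE.
have [iN|iN] /= := boolP (0 < i < N)%N; last first.
  case: (boundary_node iN) => ->.
  - by case: (bnd m).
  - by case: (bnd m).
apply/eqP; rewrite -normr_le0; apply: le_trans (le_infnorm _ iN) _.
have [m0|] := ltnP 0 m; last first.
  by rewrite leqn0 => /eqP m0; rewrite (_ : m = ord0) ?u00//; exact: val_inj.
apply: le_trans (DIDS_stable uP m0) _.
rewrite u00 add0r big1_idem ?mulr0// => [|s _]; first exact: maxxx.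
by rewrite norm0 mul0r.
Qed.

Lemma DIDS_unique (f : R -> R -> R) (phi : R -> R) :
  exists! u : 'M[R]_(M.+1, N.+1), DIDS gamma alpha mu T l kappa f phi r u.
Proof.
have [u uE] := injective_endo_surj DIDS_op_ker (DIDS_rhs f phi).
exists u; split=> [|v /DIDS_opP vE]; first exact/DIDS_opP.
by apply/eqP; rewrite -subr_eq0; apply/eqP/DIDS_op_ker; rewrite linearB/= vE uE subrr.
Qed.

End scheme.

Theorem theorem2p3 (R : realType) (gamma alpha mu T l : R)
    (kappa f : R -> R -> R) (phi : R -> R) (M N r : nat)
    (gamma_gt0 : 0 < gamma) (gamma_lt1 : gamma < 1)
    (alpha_gt0 : 0 < alpha) (alpha_lt2 : alpha < 2)
    (mu_gt : alpha < mu) (mu_le2 : mu <= 2)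
    (T_gt0 : 0 < T) (l_gt0 : 0 < l)
    (kappa_gt0 : forall x t : R, - l < x < l -> 0 <= t <= T -> 0 < kappa x t)
    (M_gt0 : (0 < M)%N) (N_gt0 : (0 < N)%N) (r_gt0 : (0 < r)%N) :
  (exists! u : 'M[R]_(M.+1, N.+1),
     DIDS gamma alpha mu T l kappa f phi r u) /\
  (forall u : 'M[R]_(M.+1, N.+1),
     DIDS gamma alpha mu T l kappa f phi r u ->
     forall k : 'I_M.+1, (0 < k)%N ->
       infnorm (u k) <=
         infnorm (u ord0) +
         Gamma (1 - gamma) *
           \big[Num.max/0]_(1 <= s < k.+1)
             (infnorm (fun i : 'I_N.+1 => f (xgrid l N i) (tgrid T M r s))
              / acoef gamma T M r s 1)).
Proof.
split; first exact: DIDS_unique.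
by move=> u uP k k0; apply: DIDS_stable uP k k0.
Qed.
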